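(* Let $\Omega=\mathbb{T}\times(0,h)$ with $h>0$, let $\alpha>0$ and $f>0$ be constants, and let $\Psi$ be a (sufficiently smooth) gravity potential on $\Omega$. Let $(\rho,u,v,w,p)$ be a smooth solution on $\Omega$ of the steady rotating Boussinesq equations $$\begin{cases} u\,\partial_x\rho+w\,\partial_z\rho=0,\\ u\,\partial_x u+w\,\partial_z u=\nu_1(\partial_x^2u+\partial_z^2u)+fv-\partial_xp-\rho\,\partial_x\Psi,\\ u\,\partial_x v+w\,\partial_z v=\nu_2(\partial_x^2v+\partial_z^2v)-fu,\\ u\,\partial_x w+w\,\partial_z w=\nu_3(\partial_x^2w+\partial_z^2w)-\partial_zp-\rho\,\partial_z\Psi,\\ \partial_xu+\partial_zw=0.\end{cases}$$ (a) Suppose $\nu_1,\nu_2,\nu_3>0$ and the boundary conditions $$\partial_zu|_{z=h}=\partial_zv|_{z=h}=w|_{z=h}=0,\qquad (\alpha u-\partial_zu)|_{z=0}=(\alpha v-\partial_zv)|_{z=0}=w|_{z=0}=0$$ hold. Then $u=v=w=0$ and $-\nabla p=\rho\nabla\Psi$ in $\Omega$. (b) Suppose $\nu_2=0$, $\nu_1,\nu_3>0$ and the boundary conditions $$\partial_zu|_{z=h}=w|_{z=h}=0,\qquad (\alpha u-\partial_zu)|_{z=0}=w|_{z=0}=0$$ hold. Then $u=w=0$, and $(\rho,v,p)=(\rho_s,v_s,p_s)$ satisfies the geostrophic balance and the hydrostatic balance $$fv_s-\partial_xp_s=\rho_s\,\partial_x\Psi,\qquad -\partial_zp_s=\rho_s\,\partial_z\Psi\qquad\text{in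 }\Omega.$$
   Context: $\mathbb{T}$ is the one-dimensional torus (functions are periodic in $x$), points of $\Omega$ are written $(x,z)$, and $\nabla=(\partial_x,\partial_z)^T$. Here $\rho$ is the density, $(u,v,w)$ the velocity, $p$ the pressure, $\nu_1,\nu_2,\nu_3$ the viscosity coefficients and $f$ the Coriolis parameter. *)

(* Defs.v *)
From Stdlib Require Import Reals.
From Coquelicot Require Import Coquelicot.
Open Scope R_scope.

(** A function on [Omega = T x (0,h)], with [T = R/LZ], is represented by a
    function [g : R -> R -> R] of [(x, z)] that is [L]-periodic in [x] for
    [0 < z < h]. The values of [g] outside [0 < z < h] are irrelevant: no
    definition below depends on them, and traces at [z = 0] and [z = h] are
    one-sided limits from inside. *)
Definition x_periodic (L h : R) (g : R -> R -> R) : Prop :=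
  forall x z, 0 < z < h -> g (x + L) z = g x z.

Definition partial_x (g : R -> R -> R) (x z : R) : R := Derive (fun x' => g x' z) x.
Definition partial_z (g : R -> R -> R) (x z : R) : R := Derive (fun z' => g x z') z.

Definition laplacian (g : R -> R -> R) (x z : R) : R :=
  partial_x (partial_x g) x z + partial_z (partial_z g) x z.

Definition advect (u w g : R -> R -> R) (x z : R) : R :=
  u x z * partial_x g x z + w x z * partial_z g x z.

Definition closed_strip (h : R) (P : R * R) : Prop := 0 <= snd P <= h.

Definition extends_continuously (h : R) (g : R -> R -> R) : Prop :=
  exists G : R * R -> R,
    (forall P, closed_strip h P ->
       filterlim G (within (closed_strip h) (locally P)) (locally (G P))) /\
    (forall x z, 0 < z < h -> G (x, z) = g x z).

(** [C^k] up to the boundary: all partial derivatives of order at most [k]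
    exist in the open strip and extend continuously to the closed strip. *)
Fixpoint Ck_closure (h : R) (k : nat) (g : R -> R -> R) : Prop :=
  extends_continuously h g /\
  match k with
  | O => True
  | S k' =>
      (forall x z, 0 < z < h ->
         ex_derive (fun x' => g x' z) x /\ ex_derive (fun z' => g x z') z) /\
      Ck_closure h k' (partial_x g) /\ Ck_closure h k' (partial_z g)
  end.

Definition smooth_on_Omega (L h : R) (k : nat) (g : R -> R -> R) : Prop :=
  x_periodic L h g /\ Ck_closure h k g.

Definition vanishes_at_top (h : R) (g : R -> R -> R) : Prop :=
  forall x, filterlim (fun z => g x z) (at_left h) (locally 0).

Definition vanishes_at_bottom (g : R -> R -> R) : Prop :=
  forall x, filterlim (fun z => g x z) (at_right 0) (locally 0).

Definition boussinesq_eqs (h f nu1 nu2 nu3 : R)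
    (Psi rho u v w p : R -> R -> R) : Prop :=
  forall x z, 0 < z < h ->
    advect u w rho x z = 0 /\
    advect u w u x z
      = nu1 * laplacian u x z + f * v x z - partial_x p x z
        - rho x z * partial_x Psi x z /\
    advect u w v x z = nu2 * laplacian v x z - f * u x z /\
    advect u w w x z
      = nu3 * laplacian w x z - partial_z p x z - rho x z * partial_z Psi x z /\
    partial_x u x z + partial_z w x z = 0.

(** Smoothness is required only to the order at which each unknown is
    differentiated in the equations. *)
Definition smooth_steady_solution (L h f nu1 nu2 nu3 : R)
    (Psi rho u v w p : R -> R -> R) : Prop :=
  smooth_on_Omega L h 1 rho /\ smooth_on_Omega L h 1 p /\
  smooth_on_Omega L h 2 u /\ smooth_on_Omega L h 2 v /\
  smooth_on_Omega L h 2 w /\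
  boussinesq_eqs h f nu1 nu2 nu3 Psi rho u v w p.

Definition navier_slip (alpha h : R) (g : R -> R -> R) : Prop :=
  vanishes_at_top h (partial_z g) /\
  vanishes_at_bottom (fun x z => alpha * g x z - partial_z g x z).

Definition no_penetration (h : R) (w : R -> R -> R) : Prop :=
  vanishes_at_top h w /\ vanishes_at_bottom w.

(* Main.v *)
Require Import Defs.
From Stdlib Require Import Reals Lra.
From Coquelicot Require Import Coquelicot.
Open Scope R_scope.

(** The proof is the energy method. Testing the momentum equations with
    [(u, v, w)], the Coriolis terms cancel, and incompressibility together with
    [u rho_x + w rho_z = 0] turns the advection, pressure and gravity terms into
    the divergence of [(u, w)] times [B = (u^2 + v^2 + w^2)/2 + p + rho Psi]
    ([bernoulli]); it is here that the potential form of gravity matters. What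
    remains is a pointwise identity ([flux_divergence]): the divergence of the
    energy flux [(flux_x, flux_z)] is
    [nu1 |grad u|^2 + nu2 |grad v|^2 + nu3 |grad w|^2 >= 0].

    Rather than integrating over the whole domain, consider the total vertical
    flux [Phi(z)], the integral of [flux_z] over one period at height [z]. By
    periodicity its derivative is the integral of the dissipation, so [Phi] is
    nondecreasing. At [z = h] the boundary conditions give [Phi(h) = 0]; at
    [z = 0] the slip condition [u_z = alpha u] makes the flux
    [alpha (nu1 u^2 + nu2 v^2) >= 0], so [Phi(0) >= 0]. Hence [Phi] vanishes
    identically and so does the dissipation. This is
    [nonneg_divergence_vanishes], applied in [energy_dissipation_vanishes].

    The components with positive viscosity are then constant on every vertical
    line, and the condition at [z = 0] forces that constant to be zero. Inserting
    [u = w = 0] (and [v = 0] if [nu2 > 0]) in the momentum equations leaves the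
    stated balances. For [nu2 = 0] the field [v] contributes neither dissipation
    nor boundary flux, so both cases come from the same estimate. *)

(** * Functions continuous up to the boundary *)

Definition clamp (h z : R) : R := Rmax 0 (Rmin z h).

Lemma clamp_bounds (h z : R) : 0 < h -> 0 <= clamp h z <= h.
Proof.
  intros hh; unfold clamp, Rmax, Rmin; repeat destruct Rle_dec; lra.
Qed.

Lemma clamp_id (h z : R) : 0 <= z <= h -> clamp h z = z.
Proof.
  intros hz; unfold clamp, Rmax, Rmin; repeat destruct Rle_dec; lra.
Qed.

Lemma clamp_lipschitz (h y z : R) : Rabs (clamp h y - clamp h z) <= Rabs (y - z).
Proof.
  unfold clamp, Rmax, Rmin, Rabs;
  repeat destruct Rle_dec; repeat destruct Rcase_abs; lra.
Qed.

(** Composing with [clamp] in [z] gives an extension that is continuous on the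
    whole plane, so that two-sided continuity and integration results apply
    at the boundary lines as well. *)
Lemma extends_continuously_plane (h : R) (g : R -> R -> R) :
  0 < h ->
  extends_continuously h g <->
  exists G : R -> R -> R,
    (forall x z, continuity_2d_pt G x z) /\
    (forall x z, 0 < z < h -> G x z = g x z).
Proof.
  intros hh; split.
  - intros [G [cG eG]].
    exists (fun x z => G (x, clamp h z)); split.
    + intros x z; apply continuity_2d_pt_filterlim; simpl.
      assert (hc : closed_strip h (x, clamp h z)) by apply (clamp_bounds h z hh).
      apply (filterlim_comp _ _ _ (fun P : R * R => (fst P, clamp h (snd P))) G
               _ (within (closed_strip h) (locally (x, clamp h z)))).
      2: exact (cG _ hc).
      intros S [e he]; exists e; intros [x' z'] [b1 b2].
      apply he; [split; [exact b1 |] | apply (clamp_bounds h z' hh)].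
      apply (Rle_lt_trans _ (Rabs (z' - z))); [apply clamp_lipschitz | exact b2].
    + intros x z hz; rewrite clamp_id by lra; apply eG, hz.
  - intros [G [cG eG]].
    exists (fun P => G (fst P) (snd P)); split.
    + intros [x z] _; apply (filterlim_filter_le_1 (F := locally (x, z))).
      * apply filter_le_within.
      * apply continuity_2d_pt_filterlim, cG.
    + exact eG.
Qed.

Lemma near_strip (h z : R) : 0 < z < h -> locally z (fun y => 0 < y < h).
Proof.
  intros [z0 zh]; apply filter_and; [exact (open_gt 0 z z0) | exact (open_lt h z zh)].
Qed.

Lemma extends_continuity (h : R) (g : R -> R -> R) (x z : R) :
  extends_continuously h g -> 0 < z < h -> continuity_2d_pt g x z.
Proof.
  intros eg hz.
  destruct (proj1 (extends_continuously_plane h g ltac:(lra)) eg) as [G [cG eG]].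
  apply (continuity_2d_pt_ext_loc G); [| apply cG].
  destruct (near_strip h z hz) as [e he].
  exists e; intros y t _ ht; apply eG, he, ht.
Qed.

Lemma continuity_2d_pt_swap (g : R -> R -> R) (x y : R) :
  continuity_2d_pt g x y -> continuity_2d_pt (fun b a => g a b) y x.
Proof.
  intros cg e; destruct (cg e) as [d hd]; exists d; intros b a hb ha.
  exact (hd a b ha hb).
Qed.

Lemma continuity_2d_pt_slice_r (g : R -> R -> R) (x y : R) :
  continuity_2d_pt g x y -> continuous (g x) y.
Proof.
  intros cg; apply filterlim_locally; intros e.
  destruct (cg e) as [d hd]; exists d; intros t ht; apply hd; [| exact ht].
  rewrite Rminus_diag, Rabs_R0; apply cond_pos.
Qed.

Lemma continuity_2d_pt_slice_l (g : R -> R -> R) (x y : R) :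
  continuity_2d_pt g x y -> continuous (fun t => g t y) x.
Proof.
  intros cg; exact (continuity_2d_pt_slice_r _ y x (continuity_2d_pt_swap g x y cg)).
Qed.

Lemma trace_bottom (h : R) (G g : R -> R -> R) (x : R) :
  0 < h -> continuity_2d_pt G x 0 ->
  (forall x z, 0 < z < h -> G x z = g x z) ->
  filterlim (g x) (at_right 0) (locally (G x 0)).
Proof.
  intros hh cG eG.
  apply (filterlim_ext_loc (G x)).
  - exists (mkposreal h hh); intros z hz z0; apply eG; split; [exact z0 |].
    change (Rabs (z - 0) < h) in hz; apply Rabs_lt_between in hz; lra.
  - apply (filterlim_filter_le_1 (F := locally 0)); [apply filter_le_within |].
    exact (continuity_2d_pt_slice_r G x 0 cG).
Qed.

Lemma trace_top (h : R) (G g : R -> R -> R) (x : R) :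
  0 < h -> continuity_2d_pt G x h ->
  (forall x z, 0 < z < h -> G x z = g x z) ->
  filterlim (g x) (at_left h) (locally (G x h)).
Proof.
  intros hh cG eG.
  apply (filterlim_ext_loc (G x)).
  - exists (mkposreal h hh); intros z hz zh; apply eG; split; [| exact zh].
    change (Rabs (z - h) < h) in hz; apply Rabs_lt_between in hz; lra.
  - apply (filterlim_filter_le_1 (F := locally h)); [apply filter_le_within |].
    exact (continuity_2d_pt_slice_r G x h cG).
Qed.

Lemma extends_has_traces (h : R) (g : R -> R -> R) (x : R) :
  0 < h -> extends_continuously h g ->
  (exists l, filterlim (g x) (at_right 0) (locally l)) /\
  (exists l, filterlim (g x) (at_left h) (locally l)).
Proof.
  intros hh eg; destruct (proj1 (extends_continuously_plane h g hh) eg) as [G [cG eG]].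
  split; eexists.
  - apply (trace_bottom h G g x hh (cG _ _) eG).
  - apply (trace_top h G g x hh (cG _ _) eG).
Qed.

Lemma extends_ext (h : R) (g k : R -> R -> R) :
  (forall x z, 0 < z < h -> g x z = k x z) ->
  extends_continuously h g -> extends_continuously h k.
Proof.
  intros e [G [cG eG]]; exists G; split; [exact cG |].
  intros x z hz; rewrite eG by exact hz; apply e, hz.
Qed.

Lemma extends_const (h c : R) : extends_continuously h (fun _ _ => c).
Proof.
  exists (fun _ => c); split; [| reflexivity].
  intros P _; apply filterlim_const.
Qed.

Lemma extends_combine (op : R -> R -> R) (h : R) (g k : R -> R -> R) :
  (forall (G K : R -> R -> R) x z, continuity_2d_pt G x z -> continuity_2d_pt K x z ->
     continuity_2d_pt (fun y t => op (G y t) (K y t)) x z) ->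
  0 < h -> extends_continuously h g -> extends_continuously h k ->
  extends_continuously h (fun x z => op (g x z) (k x z)).
Proof.
  intros cop hh eg ek; apply (extends_continuously_plane h _ hh).
  destruct (proj1 (extends_continuously_plane h g hh) eg) as [G [cG eG]].
  destruct (proj1 (extends_continuously_plane h k hh) ek) as [K [cK eK]].
  exists (fun x z => op (G x z) (K x z)); split.
  - intros x z; apply cop; [apply cG | apply cK].
  - intros x z hz; rewrite eG, eK by exact hz; reflexivity.
Qed.

Definition extends_plus (h : R) (g k : R -> R -> R) :=
  extends_combine Rplus h g k continuity_2d_pt_plus.
Definition extends_mult (h : R) (g k : R -> R -> R) :=
  extends_combine Rmult h g k continuity_2d_pt_mult.

(** * The algebra of functions that are C1 up to the boundary *)

Lemma Ck_extends (h : R) (k : nat) (g : R -> R -> R) :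
  Ck_closure h k g -> extends_continuously h g.
Proof. destruct k; intros [eg _]; exact eg. Qed.

Lemma Ck_pred (h : R) (k : nat) (g : R -> R -> R) :
  Ck_closure h (S k) g -> Ck_closure h k g.
Proof.
  revert g; induction k as [| k IH]; intros g [eg [dg [gx gz]]].
  - exact (conj eg I).
  - exact (conj eg (conj dg (conj (IH _ gx) (IH _ gz)))).
Qed.

Lemma C1_const (h c : R) : Ck_closure h 1 (fun _ _ => c).
Proof.
  split; [apply extends_const |].
  split; [intros x z _; split; apply ex_derive_const |].
  split; (split; [| exact I]); apply (extends_ext h (fun _ _ => 0));
    try apply extends_const; intros x z _; symmetry; exact (Derive_const c _).
Qed.

Lemma C1_plus (h : R) (g k : R -> R -> R) :
  0 < h -> Ck_closure h 1 g -> Ck_closure h 1 k ->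
  Ck_closure h 1 (fun x z => g x z + k x z).
Proof.
  intros hh [eg [dg [[gx _] [gz _]]]] [ek [dk [[kx _] [kz _]]]].
  split; [exact (extends_plus h g k hh eg ek) |].
  split.
  { intros x z hz; destruct (dg x z hz) as [? ?], (dk x z hz) as [? ?].
    split; apply (ex_derive_plus (K := R_AbsRing) (V := R_NormedModule)); assumption. }
  split; (split; [| exact I]).
  - apply (extends_ext h (fun x z => partial_x g x z + partial_x k x z)).
    + intros x z hz; destruct (dg x z hz) as [? ?], (dk x z hz) as [? ?].
      symmetry; apply Derive_plus; assumption.
    + exact (extends_plus h _ _ hh gx kx).
  - apply (extends_ext h (fun x z => partial_z g x z + partial_z k x z)).
    + intros x z hz; destruct (dg x z hz) as [? ?], (dk x z hz) as [? ?].
      symmetry; apply Derive_plus; assumption.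
    + exact (extends_plus h _ _ hh gz kz).
Qed.

Lemma C1_mult (h : R) (g k : R -> R -> R) :
  0 < h -> Ck_closure h 1 g -> Ck_closure h 1 k ->
  Ck_closure h 1 (fun x z => g x z * k x z).
Proof.
  intros hh [eg [dg [[gx _] [gz _]]]] [ek [dk [[kx _] [kz _]]]].
  split; [exact (extends_mult h g k hh eg ek) |].
  split.
  { intros x z hz; destruct (dg x z hz) as [? ?], (dk x z hz) as [? ?].
    split; apply ex_derive_mult; assumption. }
  split; (split; [| exact I]).
  - apply (extends_ext h (fun x z => partial_x g x z * k x z + g x z * partial_x k x z)).
    + intros x z hz; destruct (dg x z hz) as [? ?], (dk x z hz) as [? ?].
      symmetry; apply Derive_mult; assumption.
    + exact (extends_plus h _ _ hh (extends_mult h _ _ hh gx ek)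
               (extends_mult h _ _ hh eg kx)).
  - apply (extends_ext h (fun x z => partial_z g x z * k x z + g x z * partial_z k x z)).
    + intros x z hz; destruct (dg x z hz) as [? ?], (dk x z hz) as [? ?].
      symmetry; apply Derive_mult; assumption.
    + exact (extends_plus h _ _ hh (extends_mult h _ _ hh gz ek)
               (extends_mult h _ _ hh eg kz)).
Qed.

(** Periodicity is known only on the open strip, but differentiation in [x] stays
    on one horizontal line of it. *)
Lemma partial_x_periodic (L h : R) (g : R -> R -> R) :
  Ck_closure h 1 g -> x_periodic L h g -> x_periodic L h (partial_x g).
Proof.
  intros [_ [dg _]] pg x z hz; unfold partial_x.
  rewrite <- (Derive_ext (fun t => g (t + L) z) (fun t => g t z) x)
    by (intros t; apply pg, hz).
  symmetry; apply is_derive_unique.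
  replace (Derive (fun t => g t z) (x + L)) with (1 * Derive (fun t => g t z) (x + L))
    by ring.
  apply (is_derive_comp (K := R_AbsRing) (V := R_NormedModule) (fun t => g t z) (fun t => t + L)).
  - apply Derive_correct, dg, hz.
  - auto_derive; [exact I | ring].
Qed.

(** * A divergence principle on the periodic strip *)

(** Uniform continuity on the compact set [[a, b] x {z}] makes the integrands
    uniformly close. *)
Lemma continuity_RInt_param (G : R -> R -> R) (a b : R) :
  a <= b -> (forall x z, continuity_2d_pt G x z) ->
  forall z, continuous (fun z => RInt (fun x => G x z) a b) z.
Proof.
  intros ab cG z; apply filterlim_locally; intros e.
  assert (he : 0 < e / (b - a + 1)) by (apply Rdiv_lt_0_compat; [apply cond_pos | lra]).
  destruct (uniform_continuity_2d_1d G a b z (fun x _ => cG x z) (mkposreal _ he))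
    as [d hd].
  exists d; intros y hy.
  change (Rabs (y - z) < d) in hy; apply Rabs_lt_between in hy.
  change (Rabs (RInt (fun x => G x y) a b - RInt (fun x => G x z) a b) < e).
  assert (I : forall t, ex_RInt (fun x => G x t) a b).
  { intros t; apply (ex_RInt_continuous (V := R_CompleteNormedModule)).
    intros x _; apply continuity_2d_pt_slice_l, cG. }
  rewrite <- (RInt_minus (V := R_CompleteNormedModule)) by apply I.
  apply (Rle_lt_trans _ ((b - a) * (e / (b - a + 1)))).
  - apply abs_RInt_le_const; [exact ab | apply (ex_RInt_minus (V := R_NormedModule)); apply I |].
    intros x hx; apply Rlt_le, (hd x z x y); try lra.
    rewrite Rminus_diag, Rabs_R0; apply cond_pos.
  - apply (Rmult_lt_reg_r (b - a + 1)); [lra |].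
    replace ((b - a) * (e / (b - a + 1)) * (b - a + 1)) with ((b - a) * e) by (field; lra).
    pose proof (cond_pos e); nra.
Qed.

(** A positive value would persist on a small interval and make the integral
    positive. *)
Lemma RInt_eq_0_nonneg (g : R -> R) (a b : R) :
  (forall x, continuous g x) -> (forall x, 0 <= g x) -> RInt g a b = 0 ->
  forall x, a < x < b -> g x = 0.
Proof.
  intros cg pg I0 x hx.
  destruct (Rle_lt_or_eq_dec _ _ (pg x)) as [gx |]; [exfalso | congruence].
  assert (ex : forall s t, ex_RInt g s t).
  { intros s t; apply (ex_RInt_continuous (V := R_CompleteNormedModule)); intros; apply cg. }
  assert (N : locally x (fun t => 0 < g t /\ a < t < b)).
  { apply filter_and; [exact (cg x _ (open_gt 0 (g x) gx)) |].
    apply filter_and; [exact (open_gt a x (proj1 hx)) | exact (open_lt b x (proj2 hx))]. }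
  destruct N as [e he].
  pose proof (cond_pos e).
  assert (near : forall t, x - e / 2 <= t <= x + e / 2 -> 0 < g t /\ a < t < b).
  { intros t ht; apply he; apply Rabs_lt_between; unfold minus, plus, opp; simpl; lra. }
  assert (ends : a < x - e / 2 /\ x + e / 2 < b)
    by (split; apply near; lra).
  assert (mid : 0 < RInt g (x - e / 2) (x + e / 2)).
  { apply RInt_gt_0; [lra | intros t ht; apply near; lra | intros; apply cg]. }
  assert (left : 0 <= RInt g a (x - e / 2))
    by (apply RInt_ge_0; [lra | apply ex | intros; apply pg]).
  assert (right : 0 <= RInt g (x + e / 2) b)
    by (apply RInt_ge_0; [lra | apply ex | intros; apply pg]).
  rewrite <- (RInt_Chasles g a (x - e / 2) b) in I0 by apply ex.
  rewrite <- (RInt_Chasles g (x - e / 2) (x + e / 2) b) in I0 by apply ex.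
  unfold plus in I0; simpl in I0; lra.
Qed.

(** [phi] is nondecreasing with [phi a >= 0 >= phi b], hence zero on [[a, b]].
    The derivative is assumed only inside: for the energy flux nothing is known
    about differentiability at the boundary. *)
Lemma monotone_squeezed (phi dphi : R -> R) (a b : R) :
  (forall z, continuous phi z) ->
  (forall z, a < z < b -> is_derive phi z (dphi z)) ->
  (forall z, a < z < b -> 0 <= dphi z) ->
  0 <= phi a -> phi b <= 0 ->
  forall z, a < z < b -> dphi z = 0.
Proof.
  intros cphi Dphi pos pa pb.
  assert (mono : forall s t, a <= s -> s <= t -> t <= b -> phi s <= phi t).
  { intros s t as_ st tb.
    (* The mean value point may be an endpoint, where nothing is known of [dphi];
       its absolute value is a derivative inside and nonnegative everywhere. *)
    destruct (MVT_gen phi s t (fun z => Rabs (dphi z))) as [c [_ E]].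
    - rewrite Rmin_left, Rmax_right by lra; intros y hy.
      rewrite Rabs_pos_eq by (apply pos; lra); apply Dphi; lra.
    - intros y _; apply continuity_pt_filterlim, cphi.
    - pose proof (Rabs_pos (dphi c)); nra. }
  assert (zero : forall z, a < z < b -> phi z = 0).
  { intros z hz; pose proof (mono a z); pose proof (mono z b); lra. }
  intros z hz.
  apply (is_derive_unique phi z) in Dphi as E; [| exact hz].
  rewrite <- E, (Derive_ext_loc phi (fun _ => 0)); [apply Derive_const |].
  generalize (filter_and _ _ (open_gt a z (proj1 hz)) (open_lt b z (proj2 hz))).
  apply filter_imp; exact zero.
Qed.

(** The integral of [F2] over a period, as a function of [z], has as derivative the
    integral of the divergence, because the integral of [partial_x F1] over a
    period is zero. It is therefore nondecreasing, while the signs of the traces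
    of [F2] make it nonnegative at the bottom and nonpositive at the top.
    Taking the traces as arbitrary limits [l] spares naming the extension. *)
Lemma nonneg_divergence_vanishes (L h : R) (F1 F2 : R -> R -> R) :
  0 < L -> 0 < h ->
  x_periodic L h F1 -> Ck_closure h 1 F1 -> Ck_closure h 1 F2 ->
  (forall x z, 0 < z < h -> 0 <= partial_x F1 x z + partial_z F2 x z) ->
  (forall x l, filterlim (F2 x) (at_right 0) (locally l) -> 0 <= l) ->
  (forall x l, filterlim (F2 x) (at_left h) (locally l) -> l <= 0) ->
  forall x z, 0 < z < h -> partial_x F1 x z + partial_z F2 x z = 0.
Proof.
  intros hL hh per [_ [d1 [[e1x _] _]]] [e2 [d2 [_ [e2z _]]]] pos bot top x z hz.
  destruct (proj1 (extends_continuously_plane h F2 hh) e2) as [G [cG eG]].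
  assert (zG : forall t y, 0 < y < h ->
             locally y (fun s => F2 t s = G t s) /\
             Derive (fun s => G t s) y = partial_z F2 t y).
  { intros t y hy.
    assert (N : locally y (fun s => F2 t s = G t s)).
    { generalize (near_strip h y hy); apply filter_imp.
      intros s hs; symmetry; apply eG, hs. }
    split; [exact N | symmetry; apply Derive_ext_loc, N]. }
  (* A period centred at [x], so that [x] is an interior point of it. *)
  set (a := x - L / 2); set (b := a + L).
  assert (ab : a <= b) by (unfold b; lra).
  assert (cx : forall y t, 0 < y < h -> continuous (fun t => partial_x F1 t y) t).
  { intros y t hy; apply continuity_2d_pt_slice_l, (extends_continuity h); assumption. }
  assert (cz : forall y t, 0 < y < h -> continuous (fun t => partial_z F2 t y) t).
  { intros y t hy; apply continuity_2d_pt_slice_l, (extends_continuity h); assumption. }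
  assert (ix : forall y, 0 < y < h -> ex_RInt (fun t => partial_x F1 t y) a b).
  { intros y hy; apply (ex_RInt_continuous (V := R_CompleteNormedModule)).
    intros t _; apply cx, hy. }
  assert (iz : forall y, 0 < y < h -> ex_RInt (fun t => partial_z F2 t y) a b).
  { intros y hy; apply (ex_RInt_continuous (V := R_CompleteNormedModule)).
    intros t _; apply cz, hy. }
  assert (Dphi : forall y, 0 < y < h ->
            is_derive (fun s => RInt (fun t => G t s) a b) y
              (RInt (fun t => partial_x F1 t y + partial_z F2 t y) a b)).
  { intros y hy.
    assert (E : RInt (fun t => partial_x F1 t y + partial_z F2 t y) a b
                = RInt (fun t => Derive (fun s => G t s) y) a b).
    { rewrite (RInt_plus (V := R_CompleteNormedModule) _ _ _ _ (ix y hy) (iz y hy)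
               : RInt (fun t => partial_x F1 t y + partial_z F2 t y) a b = _).
      assert (Z : RInt (fun t => partial_x F1 t y) a b = 0).
      { unfold partial_x; rewrite (RInt_Derive (fun t => F1 t y)).
        - unfold b; rewrite (per a y hy); apply Rminus_diag.
        - intros t _; exact (proj1 (d1 t y hy)).
        - intros t _; apply cx, hy. }
      rewrite Z; unfold plus; simpl; rewrite Rplus_0_l.
      apply RInt_ext; intros t _; symmetry; exact (proj2 (zG t y hy)). }
    rewrite E.
    apply (is_derive_RInt_param (fun s t => G t s)).
    - generalize (near_strip h y hy); apply filter_imp; intros s hs t _.
      apply (ex_derive_ext_loc (F2 t)); [exact (proj1 (zG t s hs)) | exact (proj2 (d2 t s hs))].
    - intros t _; apply continuity_2d_pt_swap with (g := fun t s => Derive (fun r => G t r) s).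
      apply (continuity_2d_pt_ext_loc (partial_z F2)).
      + destruct (near_strip h y hy) as [e he].
        exists e; intros r s _ hs; symmetry; exact (proj2 (zG r s (he s hs))).
      + apply (extends_continuity h); assumption.
    - apply filter_forall; intros s; apply (ex_RInt_continuous (V := R_CompleteNormedModule)).
      intros t _; apply continuity_2d_pt_slice_l, cG. }
  apply (RInt_eq_0_nonneg (fun t => partial_x F1 t z + partial_z F2 t z) a b).
  - intros t; exact (continuous_plus (V := R_NormedModule) _ _ t (cx z t hz) (cz z t hz)).
  - intros t; apply pos, hz.
  - revert z hz.
    apply (monotone_squeezed (fun s => RInt (fun t => G t s) a b)).
    + intros y; apply continuity_RInt_param; assumption.
    + exact Dphi.
    + intros y hy; apply RInt_ge_0; [exact ab | | intros t _; apply pos, hy].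
      exact (ex_RInt_plus (V := R_NormedModule) _ _ a b (ix y hy) (iz y hy)).
    + apply RInt_ge_0; [exact ab | |].
      * apply (ex_RInt_continuous (V := R_CompleteNormedModule)).
        intros t _; apply continuity_2d_pt_slice_l, cG.
      * intros t _; apply (bot t), (trace_bottom h G F2 t hh (cG _ _) eG).
    + apply Ropp_le_cancel; rewrite Ropp_0.
      rewrite <- (RInt_opp (V := R_CompleteNormedModule)).
      2: { apply (ex_RInt_continuous (V := R_CompleteNormedModule)).
           intros t _; apply continuity_2d_pt_slice_l, cG. }
      apply RInt_ge_0; [exact ab | |].
      * apply (ex_RInt_continuous (V := R_CompleteNormedModule)).
        intros t _; apply (continuous_opp (V := R_NormedModule)).
        apply continuity_2d_pt_slice_l, cG.
      * intros t _; apply Ropp_0_ge_le_contravar, Rle_ge.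
        apply (top t), (trace_top h G F2 t hh (cG _ _) eG).
  - unfold a, b, a; lra.
Qed.

(** * The energy identity *)

Lemma lim_plus {T : Type} (F : (T -> Prop) -> Prop) {FF : Filter F} (g k : T -> R) (a b : R) :
  filterlim g F (locally a) -> filterlim k F (locally b) ->
  filterlim (fun t => g t + k t) F (locally (a + b)).
Proof.
  intros hg hk.
  exact (filterlim_comp_2 g k Rplus hg hk (filterlim_plus (V := R_NormedModule) a b)).
Qed.

Lemma lim_mult {T : Type} (F : (T -> Prop) -> Prop) {FF : Filter F} (g k : T -> R) (a b : R) :
  filterlim g F (locally a) -> filterlim k F (locally b) ->
  filterlim (fun t => g t * k t) F (locally (a * b)).
Proof.
  intros hg hk.
  exact (filterlim_comp_2 g k Rmult hg hk (filterlim_mult (K := R_AbsRing) a b)).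
Qed.

(** At the bottom [g g_z = alpha g^2 - g (alpha g - g_z)], which tends to
    [alpha g^2 >= 0]; at the top [g_z] tends to zero while [g] stays bounded. *)
Lemma slip_flux (alpha h nu : R) (g : R -> R -> R) (x : R) :
  0 < h -> 0 < alpha -> 0 <= nu -> Ck_closure h 2 g ->
  nu = 0 \/ navier_slip alpha h g ->
  (exists l, 0 <= l /\
     filterlim (fun z => nu * (g x z * partial_z g x z)) (at_right 0) (locally l)) /\
  filterlim (fun z => nu * (g x z * partial_z g x z)) (at_left h) (locally 0).
Proof.
  intros hh ha hnu [eg [_ [_ [egz _]]]] [-> | [top bot]].
  - split; [exists 0; split; [lra |] |];
      apply (filterlim_ext (fun _ => 0)); try (intros; ring); apply filterlim_const.
  - destruct (extends_has_traces h g x hh eg) as [[l hl] [m hm]].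
    split.
    + exists (nu * (l * (alpha * l + -1 * 0))); split.
      { replace (nu * (l * (alpha * l + -1 * 0))) with (nu * (alpha * (l * l))) by ring.
        apply Rmult_le_pos; [| apply Rmult_le_pos]; nra. }
      apply (lim_mult (at_right 0)); [apply filterlim_const |].
      apply (lim_mult (at_right 0)); [exact hl |].
      apply (filterlim_ext (fun z => alpha * g x z
                                     + -1 * (alpha * g x z - partial_z g x z)));
        [intros; ring |].
      apply (lim_plus (at_right 0)); apply (lim_mult (at_right 0)); try apply filterlim_const; [exact hl | apply bot].
    + replace 0 with (nu * (m * 0)) by ring.
      apply (lim_mult (at_left h)); [apply filterlim_const |].
      apply (lim_mult (at_left h)); [exact hm | apply top].
Qed.

(** The Bernoulli head, with potential energy density [rho Psi]. *)
Definition bernoulli (Psi rho u v w p : R -> R -> R) (x z : R) : R :=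
  (u x z * u x z + v x z * v x z + w x z * w x z) * / 2
  + (p x z + rho x z * Psi x z).

(** The flux in the energy balance: viscous flux minus transport of the Bernoulli
    head. In [flux_z] the factor [w] is pulled out of all terms that vanish at
    the boundary by no penetration alone. *)
Definition flux_x (nu1 nu2 nu3 : R) (Psi rho u v w p : R -> R -> R) (x z : R) : R :=
  nu1 * (u x z * partial_x u x z) + nu2 * (v x z * partial_x v x z)
  + (nu3 * (w x z * partial_x w x z) + -1 * (u x z * bernoulli Psi rho u v w p x z)).

Definition flux_z (nu1 nu2 nu3 : R) (Psi rho u v w p : R -> R -> R) (x z : R) : R :=
  nu1 * (u x z * partial_z u x z) + nu2 * (v x z * partial_z v x z)
  + w x z * (nu3 * partial_z w x z + -1 * bernoulli Psi rho u v w p x z).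

Ltac C1_closure hh :=
  repeat first [ assumption | apply C1_const
               | apply (C1_plus _ _ _ hh) | apply (C1_mult _ _ _ hh) ].

Definition dissipation (g : R -> R -> R) (x z : R) : R :=
  partial_x g x z * partial_x g x z + partial_z g x z * partial_z g x z.

(** The local energy identity: expanding the divergence, the difference of the two
    sides is the combination of the equations with coefficients [u], [v], [w] for
    momentum, the Bernoulli head for incompressibility and [Psi] for transport of
    [rho]. *)
Lemma flux_divergence (L h f nu1 nu2 nu3 : R) (Psi rho u v w p : R -> R -> R) :
  Ck_closure h 1 Psi ->
  smooth_steady_solution L h f nu1 nu2 nu3 Psi rho u v w p ->
  forall x z, 0 < z < h ->
    partial_x (flux_x nu1 nu2 nu3 Psi rho u v w p) x z
    + partial_z (flux_z nu1 nu2 nu3 Psi rho u v w p) x z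
    = nu1 * dissipation u x z + nu2 * dissipation v x z + nu3 * dissipation w x z.
Proof.
  intros [_ [dPsi _]] [[_ [_ [drho _]]] [[_ [_ [dp _]]]
    [[_ [_ [du [[_ [dux _]] [_ [duz _]]]]]] [[_ [_ [dv [[_ [dvx _]] [_ [dvz _]]]]]]
    [[_ [_ [dw [[_ [dwx _]] [_ [dwz _]]]]]] eqs]]]]] x z hz.
  destruct (eqs x z hz) as [Erho [Eu [Ev [Ew Ediv]]]].
  destruct (dPsi x z hz), (drho x z hz), (dp x z hz), (du x z hz), (dv x z hz), (dw x z hz).
  destruct (dux x z hz) as [? _], (dvx x z hz) as [? _], (dwx x z hz) as [? _].
  destruct (duz x z hz) as [_ ?], (dvz x z hz) as [_ ?], (dwz x z hz) as [_ ?].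
  assert (Fx : partial_x (flux_x nu1 nu2 nu3 Psi rho u v w p) x z =
    nu1 * (partial_x u x z * partial_x u x z + u x z * partial_x (partial_x u) x z)
    + nu2 * (partial_x v x z * partial_x v x z + v x z * partial_x (partial_x v) x z)
    + nu3 * (partial_x w x z * partial_x w x z + w x z * partial_x (partial_x w) x z)
    - partial_x u x z * bernoulli Psi rho u v w p x z
    - u x z * (u x z * partial_x u x z + v x z * partial_x v x z + w x z * partial_x w x z
               + partial_x p x z + partial_x rho x z * Psi x z
               + rho x z * partial_x Psi x z)).
  { apply is_derive_unique; unfold flux_x, bernoulli; auto_derive.
    - repeat split; assumption.
    - unfold partial_x; field. }
  assert (Fz : partial_z (flux_z nu1 nu2 nu3 Psi rho u v w p) x z =
    nu1 * (partial_z u x z * partial_z u x z + u x z * partial_z (partial_z u) x z)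
    + nu2 * (partial_z v x z * partial_z v x z + v x z * partial_z (partial_z v) x z)
    + nu3 * (partial_z w x z * partial_z w x z + w x z * partial_z (partial_z w) x z)
    - partial_z w x z * bernoulli Psi rho u v w p x z
    - w x z * (u x z * partial_z u x z + v x z * partial_z v x z + w x z * partial_z w x z
               + partial_z p x z + partial_z rho x z * Psi x z
               + rho x z * partial_z Psi x z)).
  { apply is_derive_unique; unfold flux_z, bernoulli; auto_derive.
    - repeat split; assumption.
    - unfold partial_z; field. }
  rewrite Fx, Fz.
  apply Rminus_diag_eq in Eu, Ev, Ew.
  unfold dissipation, advect, laplacian in *.
  apply Rminus_diag_uniq.
  set (B := bernoulli Psi rho u v w p x z).
  match type of Eu with ?a = _ => match type of Ev with ?b = _ =>
  match type of Ew with ?c = _ => match type of Ediv with ?d = _ =>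
  match type of Erho with ?r = _ =>
    transitivity (- u x z * a - v x z * b - w x z * c - B * d - Psi x z * r)
  end end end end end.
  - ring.
  - rewrite Eu, Ev, Ew, Ediv, Erho; ring.
Qed.

(** On the boundary [flux_z] reduces to the slip fluxes of [u] and [v], since [w]
    tends to zero and multiplies a bounded factor. Allowing a zero viscosity in
    place of each slip condition covers the case of inviscid [v]. *)
Lemma energy_dissipation_vanishes (L h alpha f nu1 nu2 nu3 : R)
    (Psi rho u v w p : R -> R -> R) :
  0 < L -> 0 < h -> 0 < alpha -> 0 <= nu1 -> 0 <= nu2 -> 0 <= nu3 ->
  smooth_on_Omega L h 1 Psi ->
  smooth_steady_solution L h f nu1 nu2 nu3 Psi rho u v w p ->
  nu1 = 0 \/ navier_slip alpha h u ->
  nu2 = 0 \/ navier_slip alpha h v ->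
  no_penetration h w ->
  forall x z, 0 < z < h ->
    nu1 * dissipation u x z + nu2 * dissipation v x z + nu3 * dissipation w x z = 0.
Proof.
  intros hL hh ha h1 h2 h3 [PPsi CPsi] sol su sv [wtop wbot] x z hz.
  pose proof sol as [[Prho Crho] [[Pp Cp] [[Pu Cu2] [[Pv Cv2] [[Pw Cw2] _]]]]].
  pose proof (Ck_pred h 1 u Cu2) as Cu; pose proof (Ck_pred h 1 v Cv2) as Cv;
    pose proof (Ck_pred h 1 w Cw2) as Cw.
  pose proof Cu2 as [_ [_ [Cux Cuz]]]; pose proof Cv2 as [_ [_ [Cvx Cvz]]];
    pose proof Cw2 as [_ [_ [Cwx Cwz]]].
  assert (CB : Ck_closure h 1 (bernoulli Psi rho u v w p))
    by (unfold bernoulli; C1_closure hh).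
  assert (Cq : Ck_closure h 1
            (fun x z => nu3 * partial_z w x z + -1 * bernoulli Psi rho u v w p x z))
    by C1_closure hh.
  rewrite <- (flux_divergence L h f nu1 nu2 nu3 Psi rho u v w p CPsi sol x z hz).
  apply (nonneg_divergence_vanishes L h); try assumption.
  - intros t y hy; unfold flux_x, bernoulli.
    rewrite (Pu t y hy), (Pv t y hy), (Pw t y hy), (Pp t y hy), (Prho t y hy), (PPsi t y hy).
    rewrite !(partial_x_periodic L h) by assumption; reflexivity.
  - unfold flux_x; C1_closure hh.
  - unfold flux_z; C1_closure hh.
  - intros t y hy; rewrite (flux_divergence L h f) by assumption.
    unfold dissipation; repeat apply Rplus_le_le_0_compat;
      apply Rmult_le_pos; try assumption; nra.
  - intros t l hl.
    destruct (slip_flux alpha h nu1 u t hh ha h1 Cu2 su) as [[lu [pu Lu]] _].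
    destruct (slip_flux alpha h nu2 v t hh ha h2 Cv2 sv) as [[lv [pv Lv]] _].
    destruct (extends_has_traces h _ t hh (Ck_extends _ _ _ Cq)) as [[q Lq] _].
    rewrite (filterlim_locally_unique (V := R_NormedModule) _ l (lu + lv + 0 * q) hl); [lra |].
    repeat apply (lim_plus (at_right 0)); try assumption.
    apply (lim_mult (at_right 0)); [apply wbot | exact Lq].
  - intros t l hl.
    destruct (slip_flux alpha h nu1 u t hh ha h1 Cu2 su) as [_ Lu].
    destruct (slip_flux alpha h nu2 v t hh ha h2 Cv2 sv) as [_ Lv].
    destruct (extends_has_traces h _ t hh (Ck_extends _ _ _ Cq)) as [_ [q Lq]].
    rewrite (filterlim_locally_unique (V := R_NormedModule) _ l (0 + 0 + 0 * q) hl); [lra |].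
    repeat apply (lim_plus (at_left h)); try assumption.
    apply (lim_mult (at_left h)); [apply wtop | exact Lq].
Qed.

(** * From zero dissipation to the equilibrium *)

Lemma dissipation_ge_0 (g : R -> R -> R) (x z : R) : 0 <= dissipation g x z.
Proof. unfold dissipation; nra. Qed.

Lemma dissipation_eq_0 (nu : R) (g : R -> R -> R) (x z : R) :
  0 < nu -> nu * dissipation g x z = 0 -> partial_z g x z = 0.
Proof.
  intros hnu E; apply Rmult_integral in E as [E | E]; [lra |].
  exact (proj2 (Rplus_sqr_eq_0 _ _ E)).
Qed.

Lemma flat_columns_vanish (h : R) (g : R -> R -> R) :
  0 < h -> Ck_closure h 1 g ->
  (forall x z, 0 < z < h -> partial_z g x z = 0) -> vanishes_at_bottom g ->
  forall x z, 0 < z < h -> g x z = 0.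
Proof.
  intros hh [_ [dg _]] flat bot x z hz.
  apply (filterlim_locally_unique (V := R_NormedModule) (F := at_right 0) (g x)); [| apply bot].
  apply (filterlim_ext_loc (fun _ => g x z)); [| apply filterlim_const].
  exists (mkposreal h hh); intros y hy y0.
  change (Rabs (y - 0) < h) in hy; apply Rabs_lt_between in hy.
  assert (closed_range : forall t, Rmin y z <= t <= Rmax y z -> 0 < t < h)
    by (intros t; unfold Rmin, Rmax; destruct Rle_dec; lra).
  assert (range : forall t, Rmin y z < t < Rmax y z -> 0 < t < h)
    by (intros t ht; apply closed_range; lra).
  destruct (MVT_gen (g x) y z (fun _ => 0)) as [c [_ E]].
  - intros t ht; apply range in ht; rewrite <- (flat x t ht).
    exact (Derive_correct _ _ (proj2 (dg x t ht))).
  - intros t ht; apply continuity_pt_filterlim.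
    apply (ex_derive_continuous (K := R_AbsRing) (V := R_NormedModule)).
    exact (proj2 (dg x t (closed_range t ht))).
  - lra.
Qed.

(** If [partial_z g = 0], the slip condition says that [alpha g] tends to zero at
    the bottom. *)
Lemma flat_slip_vanishes (alpha h : R) (g : R -> R -> R) :
  0 < h -> 0 < alpha -> Ck_closure h 1 g -> navier_slip alpha h g ->
  (forall x z, 0 < z < h -> partial_z g x z = 0) ->
  forall x z, 0 < z < h -> g x z = 0.
Proof.
  intros hh ha Cg [_ bot] flat; apply (flat_columns_vanish h); try assumption.
  intros x.
  replace 0 with (/ alpha * 0) at 2 by ring.
  apply (filterlim_ext_loc (fun z => / alpha * (alpha * g x z - partial_z g x z))).
  - exists (mkposreal h hh); intros z hz z0.
    change (Rabs (z - 0) < h) in hz; apply Rabs_lt_between in hz.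
    rewrite flat by lra; field; lra.
  - apply (lim_mult (at_right 0)); [apply filterlim_const | apply bot].
Qed.

Lemma zero_on_strip (h : R) (g : R -> R -> R) :
  (forall x z, 0 < z < h -> g x z = 0) ->
  forall x z, 0 < z < h -> partial_x g x z = 0 /\ partial_z g x z = 0.
Proof.
  intros E x z hz; split.
  - unfold partial_x; rewrite (Derive_ext _ (fun _ => 0)); [apply Derive_const |].
    intros t; apply E, hz.
  - unfold partial_z; rewrite (Derive_ext_loc _ (fun _ => 0)); [apply Derive_const |].
    generalize (near_strip h z hz); apply filter_imp; intros t; apply E.
Qed.

Lemma laplacian_zero_on_strip (h : R) (g : R -> R -> R) :
  (forall x z, 0 < z < h -> g x z = 0) ->
  forall x z, 0 < z < h -> laplacian g x z = 0.
Proof.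
  intros E x z hz; unfold laplacian.
  rewrite (proj1 (zero_on_strip h (partial_x g)
                    (fun x z hz => proj1 (zero_on_strip h g E x z hz)) x z hz)).
  rewrite (proj2 (zero_on_strip h (partial_z g)
                    (fun x z hz => proj2 (zero_on_strip h g E x z hz)) x z hz)).
  ring.
Qed.

(** With [u = w = 0] on the open strip all advective and viscous terms of the first
    and third momentum equations drop out. *)
Lemma rest_balances (L h f nu1 nu2 nu3 : R) (Psi rho u v w p : R -> R -> R) :
  smooth_steady_solution L h f nu1 nu2 nu3 Psi rho u v w p ->
  (forall x z, 0 < z < h -> u x z = 0) ->
  (forall x z, 0 < z < h -> w x z = 0) ->
  forall x z, 0 < z < h ->
    f * v x z - partial_x p x z = rho x z * partial_x Psi x z /\
    - partial_z p x z = rho x z * partial_z Psi x z.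
Proof.
  intros [_ [_ [_ [_ [_ eqs]]]]] U W x z hz.
  destruct (eqs x z hz) as [_ [Eu [_ [Ew _]]]].
  unfold advect in Eu, Ew.
  rewrite (U x z hz), (W x z hz), (laplacian_zero_on_strip h u U x z hz) in Eu.
  rewrite (U x z hz), (W x z hz), (laplacian_zero_on_strip h w W x z hz) in Ew.
  split; lra.
Qed.

Theorem mainTheorem1 (L h alpha f : R) (Psi : R -> R -> R)
    (hL : 0 < L) (hh : 0 < h) (halpha : 0 < alpha) (hf : 0 < f)
    (hPsi : smooth_on_Omega L h 1 Psi) :
  (forall (nu1 nu2 nu3 : R) (rho u v w p : R -> R -> R),
     0 < nu1 -> 0 < nu2 -> 0 < nu3 ->
     smooth_steady_solution L h f nu1 nu2 nu3 Psi rho u v w p ->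
     navier_slip alpha h u -> navier_slip alpha h v -> no_penetration h w ->
     forall x z, 0 < z < h ->
       u x z = 0 /\ v x z = 0 /\ w x z = 0 /\
       - partial_x p x z = rho x z * partial_x Psi x z /\
       - partial_z p x z = rho x z * partial_z Psi x z) /\
  (forall (nu1 nu2 nu3 : R) (rho u v w p : R -> R -> R),
     0 < nu1 -> nu2 = 0 -> 0 < nu3 ->
     smooth_steady_solution L h f nu1 nu2 nu3 Psi rho u v w p ->
     navier_slip alpha h u -> no_penetration h w ->
     forall x z, 0 < z < h ->
       u x z = 0 /\ w x z = 0 /\
       f * v x z - partial_x p x z = rho x z * partial_x Psi x z /\
       - partial_z p x z = rho x z * partial_z Psi x z).
Proof.
  (* The part common to both cases; [nu2 = 0] and the slip condition on [v] are
     the two ways to control the boundary flux of [v]. *)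
  assert (rest : forall (nu1 nu2 nu3 : R) (rho u v w p : R -> R -> R),
     0 < nu1 -> 0 <= nu2 -> 0 < nu3 ->
     smooth_steady_solution L h f nu1 nu2 nu3 Psi rho u v w p ->
     navier_slip alpha h u -> nu2 = 0 \/ navier_slip alpha h v -> no_penetration h w ->
     (forall x z, 0 < z < h -> u x z = 0) /\ (forall x z, 0 < z < h -> w x z = 0) /\
     (forall x z, 0 < z < h -> nu2 * dissipation v x z = 0)).
  { intros nu1 nu2 nu3 rho u v w p h1 h2 h3 sol su sv nw.
    assert (D : forall x z, 0 < z < h ->
              nu1 * dissipation u x z = 0 /\ nu2 * dissipation v x z = 0
              /\ nu3 * dissipation w x z = 0).
    { intros x z hz.
      pose proof (energy_dissipation_vanishes L h alpha f nu1 nu2 nu3 Psi rho u v w p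
                    hL hh halpha (Rlt_le _ _ h1) h2 (Rlt_le _ _ h3) hPsi sol
                    (or_intror su) sv nw x z hz).
      pose proof (Rmult_le_pos _ _ (Rlt_le _ _ h1) (dissipation_ge_0 u x z)).
      pose proof (Rmult_le_pos _ _ h2 (dissipation_ge_0 v x z)).
      pose proof (Rmult_le_pos _ _ (Rlt_le _ _ h3) (dissipation_ge_0 w x z)).
      lra. }
    destruct sol as [_ [_ [[_ Cu] [_ [[_ Cw] _]]]]].
    split; [| split].
    - apply (flat_slip_vanishes alpha h u hh halpha (Ck_pred _ _ _ Cu) su).
      intros x z hz; apply (dissipation_eq_0 nu1); [exact h1 | apply D, hz].
    - apply (flat_columns_vanish h w hh (Ck_pred _ _ _ Cw)); [| apply nw].
      intros x z hz; apply (dissipation_eq_0 nu3); [exact h3 | apply D, hz].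
    - intros x z hz; apply D, hz. }
  split.
  - intros nu1 nu2 nu3 rho u v w p h1 h2 h3 sol su sv nw.
    destruct (rest nu1 nu2 nu3 rho u v w p h1 (Rlt_le _ _ h2) h3 sol su (or_intror sv) nw)
      as [U [W D]].
    assert (V : forall x z, 0 < z < h -> v x z = 0).
    { pose proof sol as [_ [_ [_ [[_ Cv] _]]]].
      apply (flat_slip_vanishes alpha h v hh halpha (Ck_pred _ _ _ Cv) sv).
      intros x z hz; apply (dissipation_eq_0 nu2); [exact h2 | apply D, hz]. }
    intros x z hz.
    destruct (rest_balances _ _ _ _ _ _ _ _ _ _ _ _ sol U W x z hz) as [Bx Bz].
    rewrite (V x z hz) in Bx.
    repeat split; [apply U | apply V | apply W | lra | exact Bz]; exact hz.
  - intros nu1 nu2 nu3 rho u v w p h1 h2 h3 sol su nw.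
    destruct (rest nu1 nu2 nu3 rho u v w p h1 (Req_le_sym _ _ h2) h3 sol su (or_introl h2) nw)
      as [U [W _]].
    intros x z hz.
    split; [apply U, hz |]; split; [apply W, hz |].
    exact (rest_balances _ _ _ _ _ _ _ _ _ _ _ _ sol U W x z hz).
Qed.
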